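(* Let $k^*, k_1, \dots, k_s$ be positive integers ($s \geq 0$ an integer). Let $G$ be the vertex-disjoint union of the graphs $P^{k^*}, {_1C}^{k_1}, \dots, {_sC}^{k_s}$, where $P$ is a path and ${_1C}, \dots, {_sC}$ are cycles. Suppose that $1 \leq r \leq \alpha(G)$ and that $$\omega({_iC}^{k_i}) > \omega(P^{k^*}) \quad \text{for every } i \in \{1,\dots,s\}.$$ Then $G$ is $r$-EKR. Moreover, for any end-vertex $x$ of $P$, the star ${\mathcal{I}_G}^{(r)}(x)$ is a largest intersecting subfamily of ${\mathcal{I}_G}^{(r)}$.
   Context: All graphs are finite and simple. For $n\ge1$, $P_n$ is the graph on $\{1,\dots,n\}$ with edges $\{i,i+1\}$, $1\le i\le n-1$; a path is a copy of some $P_n$, and an end-vertex of a path is a vertex adjacent to at most one other vertex of the path. For $n\ge3$, $C_n$ is $P_n$ with the extra edge $\{n,1\}$; a cycle is a copy of some $C_n$. For a graph $G$ and $k\ge1$, the $k$-th power $G^k$ has vertex set $V(G)$ and edge set $\{vw : 1 \le d_G(v,w)\le k\}$, where $d_G$ is graph distance. A graph is the (vertex-)disjoint union of graphs with pairwise disjoint vertex sets if its vertex set and edge set are the unions of theirs. An independent set of $G$ is a set of pairwise non-adjacent vertices; $\mathcal{I}_G$ is the family of independent sets of $G$, and ${\mathcal{I}_G}^{(r)}$ is the family of independent sets of size $r$. $\alpha(G)$ is the maximum size of an independent set and $\omega(G)$ is the maximum size of a clique. A family of sets is intersecting if every two of its members have nonempty intersection. For a family $\mathcal{F}$ and a vertex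 $x$, the star $\mathcal{F}(x)$ is $\{A\in\mathcal{F} : x\in A\}$. $G$ is $r$-EKR if at least one of the largest intersecting subfamilies of ${\mathcal{I}_G}^{(r)}$ is a star of ${\mathcal{I}_G}^{(r)}$. *)

(* Defs.v *)
From mathcomp Require Import all_boot.

Set Implicit Arguments.
Unset Strict Implicit.
Unset Printing Implicit Defensive.

(* The vertex set is a subset of an ambient finite type, so that several graphs
   can share a universe and (disjoint) unions can be taken literally. *)
Record sgraph (T : finType) := SGraph {
  vert : {set T};
  edge : rel T;
  edge_sym : symmetric edge;
  edge_irr : irreflexive edge;
  edge_vert : forall x y, edge x y -> (x \in vert) && (y \in vert)
}.

Section Graphs.
Variable T : finType.
Implicit Types (G : sgraph T) (A B : {set T}) (F : {set {set T}}) (x y : T).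

Lemma symm_sym (V : {set T}) (e : rel T) :
  symmetric [rel x y | [&& x \in V, y \in V, x != y & e x y || e y x]].
Proof. by move=> x y /=; rewrite andbCA eq_sym [e x y || _]orbC. Qed.

Lemma symm_irr (V : {set T}) (e : rel T) :
  irreflexive [rel x y | [&& x \in V, y \in V, x != y & e x y || e y x]].
Proof. by move=> x /=; rewrite eqxx !andbF. Qed.

Lemma symm_vert (V : {set T}) (e : rel T) x y :
  [rel x y | [&& x \in V, y \in V, x != y & e x y || e y x]] x y ->
  (x \in V) && (y \in V).
Proof. by case/and3P=> -> ->. Qed.

Definition symm_graph (V : {set T}) (e : rel T) : sgraph T :=
  SGraph (@symm_sym V e) (@symm_irr V e) (@symm_vert V e).

Definition has_walk G x y (d : nat) : bool :=
  [exists p : d.-tuple T, path (edge G) x p && (last x p == y)].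

(* [None] stands for infinite distance.  A shortest walk repeats no vertex, so
   searching the lengths below #|T| suffices. *)
Definition dist G x y : option nat :=
  ohead [seq d <- iota 0 #|T| | has_walk G x y d].

Definition power_edge G (k : nat) : rel T :=
  [rel x y | if dist G x y is Some d then 1 <= d <= k else false].

Lemma has_walk_sym G x y d : has_walk G x y d = has_walk G y x d.
Proof.
suff imp u v : has_walk G u v d -> has_walk G v u d.
  by apply/idP/idP; exact: imp.
case/existsP=> p /andP[pP /eqP <-].
have sz : size (rev (belast u p)) == d by rewrite size_rev size_belast size_tuple.
apply/existsP; exists (Tuple sz) => /=.
rewrite rev_path (eq_path (e' := edge G)) ?pP /=; last first.
  by move=> a b /=; rewrite edge_sym.
case: (tval p) => [|a q] //=.
by rewrite rev_cons last_rcons.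
Qed.

Lemma power_edge_sym G k : symmetric (power_edge G k).
Proof.
move=> x y; rewrite /power_edge /dist /=.
by rewrite (eq_filter (a2 := has_walk G y x)) // => d; rewrite has_walk_sym.
Qed.

Lemma dist_walk G x y d : dist G x y = Some d -> has_walk G x y d.
Proof.
rewrite /dist; case E: (filter _ _) => [|a l] //= [<-].
have : a \in [seq d <- iota 0 #|T| | has_walk G x y d] by rewrite E mem_head.
by rewrite mem_filter; case/andP.
Qed.

Lemma power_edge_irr G k : irreflexive (power_edge G k).
Proof.
move=> x; rewrite /power_edge /dist /=.
have: 0 < #|T| by apply/card_gt0P; exists x.
case: #|T| => // n _ /=.
suff -> : has_walk G x x 0 by [].
by apply/existsP; exists [tuple]; rewrite /= eqxx.
Qed.

Lemma power_edge_vert G k x y :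
  power_edge G k x y -> (x \in vert G) && (y \in vert G).
Proof.
suff src u v : power_edge G k u v -> u \in vert G.
  by move=> e; rewrite (src _ _ e); move: e; rewrite power_edge_sym => /src.
rewrite /power_edge /=; case E: (dist G u v) => [[|d]|] // _.
have /existsP[p] := dist_walk E.
by case: p => [[|a p] // ?] /= /andP[/andP[/edge_vert/andP[]]].
Qed.

Definition power G (k : nat) : sgraph T :=
  SGraph (@power_edge_sym G k) (@power_edge_irr G k) (@power_edge_vert G k).

Definition disjoint_union (I : finType) (H : I -> sgraph T) G : Prop :=
  [/\ forall i j, i != j -> [disjoint vert (H i) & vert (H j)],
      vert G = \bigcup_i vert (H i)
    & forall x y, edge G x y = [exists i, edge (H i) x y]].

Definition independent G A : bool :=
  (A \subset vert G) && [forall x in A, forall y in A, ~~ edge G x y].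

Definition clique G A : bool :=
  (A \subset vert G) &&
  [forall x in A, forall y in A, (x != y) ==> edge G x y].

Definition alpha G : nat := \max_(A : {set T} | independent G A) #|A|.

Definition omega G : nat := \max_(A : {set T} | clique G A) #|A|.

Definition indep_family G (r : nat) : {set {set T}} :=
  [set A : {set T} | independent G A & #|A| == r].

(* The two members may coincide, which matters only for the family {set0}. *)
Definition intersecting F : bool :=
  [forall A in F, forall B in F, A :&: B != set0].

Definition star F x : {set {set T}} := [set A in F | x \in A].

Definition largest_intersecting F (F' : {set {set T}}) : Prop :=
  [/\ F' \subset F, intersecting F'
    & forall F'' : {set {set T}},
        F'' \subset F -> intersecting F'' -> #|F''| <= #|F'|].

Definition EKR G (r : nat) : Prop :=
  exists2 x, x \in vert G &
    largest_intersecting (indep_family G r) (star (indep_family G r) x).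

End Graphs.

(* The vertices 1, ..., n are represented by 0, ..., n - 1. *)
Definition path_graph (n : nat) : sgraph 'I_n :=
  symm_graph [set: 'I_n] (fun i j => j == i.+1 :> nat).

Definition cycle_graph (n : nat) : sgraph 'I_n :=
  symm_graph [set: 'I_n]
    (fun i j => (j == i.+1 :> nat) || (i == n.-1 :> nat) && (j == 0 :> nat)).

Definition is_copy (U T : finType) (H : sgraph U) (G : sgraph T) : Prop :=
  exists f : U -> T,
    [/\ {in vert H &, injective f}, f @: vert H = vert G
      & {in vert H &, forall x y, edge G (f x) (f y) = edge H x y}].

Definition is_path (T : finType) (G : sgraph T) : Prop :=
  exists2 n, 1 <= n & is_copy (path_graph n) G.

Definition is_cycle (T : finType) (G : sgraph T) : Prop :=
  exists2 n, 3 <= n & is_copy (cycle_graph n) G.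

Definition end_vertex (T : finType) (P : sgraph T) (x : T) : bool :=
  (x \in vert P) && (#|[set y | edge P x y]| <= 1).

(* Main.v *)
(* Shifting the last vertex of the path onto the previous one and deleting it
   reduces a path power to a smaller one: the bound for n path vertices and
   r-sets follows from those for (n - 1, r) and (n - 1 - k, r - 1), and the star
   at the first vertex satisfies the same recursion with equality. Once the path
   power is a clique K, the strict inequality of clique numbers says that
   rotating the cycles by 1, ..., |K| steps moves every independent set to a
   disjoint one. Rotating the links at the vertices of K by different amounts
   makes them pairwise disjoint, and disjoint from the shadow of the
   subfamily avoiding K; by Katona's theorem that shadow is at least as large
   as the intersecting subfamily itself. All these sets are independent sets of
   size r - 1 in the cycles, that is, links of members of the star. *)
Require Import Defs.
From mathcomp Require Import all_boot all_algebra zify.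

Set Implicit Arguments.
Unset Strict Implicit.
Unset Printing Implicit Defensive.

(** * Shadows of intersecting families *)

Definition shadow (T : finType) (F : {set {set T}}) : {set {set T}} :=
  [set A :\ x | A in F, x in A].

Section Shadow.
Variable T : finType.
Implicit Types (A B D : {set T}) (F : {set {set T}}).
Import GRing.Theory.
Local Open Scope ring_scope.

(** Expand the product over all [x] of [c x + 1], with [c x = -1] on [A :&: B] and [0] elsewhere:
    each common element contributes a factor zero. *)
Lemma sum_sign_subset A B :
  \sum_(D : {set T} | D \subset A :&: B) (-1) ^+ #|D| = (A :&: B == set0)%:R :> rat.
Proof.
transitivity (\prod_(x : T) ((if x \in A :&: B then -1 else 0) + 1 : rat)).
  rewrite bigA_distr [LHS]big_mkcond; apply: eq_bigr => D _ /=.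
  rewrite -big_mkcond /=.
  case: ifPn => [/subsetP sDE|/subsetPn[x xD xE]]; last first.
    by rewrite (bigD1 x) //= (negPf xE) mul0r.
  rewrite (eq_bigr (fun=> -1)) ?prodr_const // => x xD.
  by rewrite sDE.
have [->|/set0Pn[x xE]] := eqVneq; last by rewrite (bigD1 x) //= xE addNr mul0r.
by rewrite big1 // => x _; rewrite inE add0r.
Qed.

(** By cardinality, the shadow sets inside [A] are exactly the [A :\ x] with [x] in [A]. Such a set
    contains [D] iff [x] is outside [D], so the sum counts [A :\: D]. *)
Lemma sum_shadow F r A D :
  {in F, forall B, #|B| = r} -> A \in F -> D \subset A -> (#|D| < r)%N ->
  \sum_(B in shadow F) (B \subset A)%:R * (D \subset B)%:R = (r - #|D|)%:R :> rat.
Proof.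
move=> Fr AF sDA ltDr.
have shadowA B : (B \in shadow F) && (B \subset A) = (B \in [set A :\ x | x in A]).
  apply/andP/imsetP => [[/imset2P[A' x A'F xA' ->] sA]|[x xA ->]]; last first.
    by rewrite subD1set; split=> //; apply/imset2P; exists A x.
  have: #|A :\: (A' :\ x)| = 1%N.
    rewrite cardsD (setIidPr sA) (Fr A AF).
    by rewrite -(Fr A' A'F) (cardsD1 x A') xA' add1n subSnn.
  move=> /eqP/cards1P[y Ay]; exists y.
    by have := set11 y; rewrite -Ay inE => /andP[].
  by rewrite -Ay setDDr setDv set0U (setIidPr sA).
rewrite (bigID (fun B => B \subset A)) /= [X in _ + X]big1 ?addr0; last first.
  by move=> B /andP[_ /negPf->]; rewrite mul0r.
rewrite (eq_bigl _ _ shadowA) big_imset /=; last first.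
  move=> x y xA yA eqA; apply/eqP; apply: contraT => nxy.
  by have := setD11 x A; rewrite eqA !inE nxy xA.
rewrite (bigID (fun x => x \in D)) /= big1 ?add0r => [|x /andP[_ xD]]; last first.
  by rewrite subsetD1 xD andbF mulr0.
rewrite (eq_bigr (fun=> 1)) => [|x /andP[_ xD]]; last first.
  by rewrite subD1set subsetD1 sDA xD mulr1.
have <- : #|A :\: D| = (r - #|D|)%N by rewrite cardsD (setIidPr sDA) Fr.
rewrite sumr_const; congr (_%:R).
by rewrite -[LHS]cardsE; congr #|pred_of_set _|; apply/setP=> x; rewrite !inE andbC.
Qed.

(* The inclusion matrix between [F] and its shadow has full row rank: summing
   (-1)^|D| over the subsets [D] of [A0] contained in [A] detects whether [A]
   and [A0] are disjoint, which never occurs in [F], and the proper subsets of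
   [A0] are seen through the shadow. *)
Lemma leq_card_shadow F r :
  {in F, forall A, #|A| = r} -> intersecting F -> (#|F| <= #|shadow F|)%N.
Proof.
move=> Fr /forall_inP interF.
pose M : 'M[rat]_(#|F|, #|shadow F|) :=
  \matrix_(i, j) ((enum_val j : {set T}) \subset (enum_val i : {set T}))%:R.
(* Dividing by [r - #|D|] cancels the count of [sum_shadow]; the entry of [M *m N] at ([A], [A0])
   becomes the signed sum over the [D] contained in [A] and properly in [A0]. *)
pose N : 'M[rat]_(#|shadow F|, #|F|) :=
  \matrix_(j, i) \sum_(D : {set T} | D \proper (enum_val i : {set T}))
     (D \subset (enum_val j : {set T}))%:R * ((-1) ^+ #|D| / (r - #|D|)%:R).
suff MN : M *m N = (- (-1) ^+ r)%:M.
  have : row_free M.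
    apply/row_freeP; exists ((- (-1) ^+ r) *: N).
    rewrite -scalemxAr MN scale_scalar_mx mulrNN -exprD addnn -mul2n exprM.
    by rewrite sqrrN !expr1n.
  by rewrite /row_free => /eqP <-; exact: rank_leq_col.
apply/matrixP=> i i'; rewrite !mxE; set A := enum_val i; set A0 := enum_val i'.
have AF : A \in F by exact: enum_valP.
have A0F : A0 \in F by exact: enum_valP.
under eq_bigr => j _ do rewrite !mxE mulr_sumr.
rewrite exchange_big /=.
have -> : \sum_(D : {set T} | D \proper A0) \sum_(j < #|shadow F|)
     ((enum_val j : {set T}) \subset A)%:R *
     ((D \subset (enum_val j : {set T}))%:R * ((-1) ^+ #|D| / (r - #|D|)%:R))
   = \sum_(D : {set T} | (D \subset A :&: A0) && (D != A0)) (-1) ^+ #|D| :> rat.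
  have propE D : (D \proper A0) = (D \subset A0) && (D != A0).
    by rewrite properEneq andbC.
  rewrite (eq_bigl _ _ propE) (bigID (fun D => D \subset A)) /=.
  rewrite [X in _ + X]big1 ?addr0 => [|D /andP[_ nsDA]]; last first.
    rewrite big1 // => j _; rewrite !mulrA -natrM mulnb.
    case: andP => [[sA sD]|_]; last by rewrite !mul0r.
    by rewrite (subset_trans sD sA) in nsDA.
  apply: eq_big => [D|D /andP[pDA0 sDA]].
    by rewrite subsetI andbC andbA.
  have ltDr : (#|D| < r)%N by rewrite -(Fr A0 A0F) proper_card // propE.
  under eq_bigr do rewrite mulrA.
  rewrite -mulr_suml.
  rewrite -(@big_enum_val _ _ _ _ (mem (shadow F))
    (fun B : {set T} => (B \subset A)%:R * (D \subset B)%:R : rat)) /=.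
  rewrite (sum_shadow Fr) // mulrC -mulrA mulVf ?mulr1 //.
  by rewrite Num.Theory.pnatr_eq0 subn_eq0 -ltnNge.
(* The full signed sum vanishes because [A] meets [A0]. The excluded term [D = A0] occurs in it only
   if [A0] lies in [A], that is, by equal sizes, on the diagonal. *)
have := sum_sign_subset A A0.
rewrite (negPf (forall_inP (interF A AF) A0 A0F)).
rewrite (bigID (fun D => D == A0)) /= => /(canRL (addKr _)) ->.
rewrite addr0; have [eii'|ii'] := eqVneq i i'; last first.
  rewrite mulr0n big_pred0 ?oppr0 // => D; apply/negbTE/andP => -[sD /eqP eD].
  case/negP: ii'; rewrite -(inj_eq enum_val_inj) eq_sym eqEcard.
  by rewrite !Fr // leqnn andbT; move: sD; rewrite eD subsetI => /andP[].
rewrite mulr1n /A0 -eii' -/A (big_pred1 A) ?Fr // => D.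
by rewrite setIid /=; case: eqP => [->|_]; rewrite ?subxx ?andbF.
Qed.

End Shadow.

(** * Stars in graphs containing a path power *)

Section Core.
Variables (T : finType) (G : sgraph T).
Implicit Types (A B V W : {set T}) (F : {set {set T}}).

Lemma intersectingP F :
  reflect {in F &, forall A B, exists2 x, x \in A & x \in B} (intersecting F).
Proof.
apply: (iffP forall_inP) => [H A B AF BF|H A AF].
  by have /set0Pn[x /setIP[]] := forall_inP (H A AF) B BF; exists x.
apply/forall_inP=> B BF; have [x xA xB] := H A B AF BF.
by apply/set0Pn; exists x; apply/setIP.
Qed.

Lemma indepP A :
  reflect (A \subset vert G /\ {in A &, forall x y, ~~ edge G x y}) (independent G A).
Proof.
apply: (iffP andP) => -[sA H]; split=> //.
  by move=> x y xA yA; exact: (forall_inP (forall_inP H x xA) y yA).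
by apply/forall_inP=> x xA; apply/forall_inP=> y yA; exact: H.
Qed.

(** Vertices are deleted by shrinking [V] with [G] fixed, so the same adjacency facts serve
    throughout the induction. *)
Definition indep_in V r : {set {set T}} := [set A in indep_family G r | A \subset V].

Lemma indep_inP V r A :
  reflect [/\ independent G A, #|A| = r & A \subset V] (A \in indep_in V r).
Proof.
rewrite !inE; apply: (iffP idP) => [/andP[/andP[-> /eqP->] ->] //|[-> -> ->]].
by rewrite eqxx.
Qed.

Definition star_bound V x r :=
  forall F, F \subset indep_in V r -> intersecting F ->
    #|F| <= #|star (indep_in V r) x|.

Lemma star_bound0 V x : star_bound V x 0.
Proof.
move=> F sF /intersectingP iF; rewrite leqNgt; apply/negP => lt0F.
have /card_gt0P[A AF] : 0 < #|F| by exact: leq_ltn_trans lt0F.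
have /indep_inP[_ /eqP] := subsetP sF A AF.
by rewrite cards_eq0 => /eqP A0; have [y] := iF A A AF AF; rewrite A0 inE.
Qed.

Lemma indepS A B : A \subset B -> independent G B -> independent G A.
Proof.
move=> sAB /indepP[sB iB]; apply/indepP; split; first exact: subset_trans sB.
by move=> x y /(subsetP sAB) xB /(subsetP sAB); exact: iB.
Qed.

Lemma indepU1 A u : u \in vert G -> independent G A ->
  independent G (u |: A) = [forall y in A, ~~ edge G u y].
Proof.
move=> uG /indepP[sA iA]; apply/indepP/forall_inP => [[_ iu] y yA|iu].
  by apply: iu; rewrite !inE ?eqxx ?yA ?orbT.
split=> [|x y]; first by rewrite subUset sub1set uG.
rewrite !inE => /predU1P[->|xA] /predU1P[->|yA]; last exact: iA.
- by rewrite edge_irr.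
- exact: iu.
- by rewrite edge_sym iu.
Qed.

(* Replace [v] by [u] in the members of [F] whenever this gives a new
   independent set. The members then avoiding [v] and the links at [v] of the
   other ones are both intersecting families: two links for which [u] is blocked
   by a neighbour meet in [w], the only neighbour of [u] not adjacent to [v]. *)
Lemma star_bound_shift V v u w x r :
  V \subset vert G -> v \in V -> u \in V -> edge G u v ->
  {in V, forall y, edge G u y -> [\/ y = v, edge G v y | y = w]} ->
  x != v -> ~~ edge G v x ->
  star_bound (V :\ v) x r.+1 -> star_bound [set y in V :\ v | ~~ edge G v y] x r ->
  star_bound V x r.+1.
Proof.
move=> sV vV uV euv nbu xv nvx bound1 bound2 F sF /intersectingP iF.
have uv : u != v by apply: contraTneq euv => ->; rewrite edge_irr.
have vG := subsetP sV v vV; have uG := subsetP sV u uV.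
pose phi A := u |: (A :\ v).
pose Fnew := [set A in F | [&& v \in A, phi A \notin F & independent G (phi A)]].
pose Frest := [set A in F |
  (v \in A) && ~~ ((phi A \notin F) && independent G (phi A))].
pose Fold := [set A in F | v \notin A].
pose F1 := Fold :|: phi @: Fnew.
pose F2 := [set A :\ v | A in Frest].
have uNA A : A \in F -> v \in A -> u \notin A.
  move=> AF vA; apply/negP => uA; have /indep_inP[/indepP[_ iA] _ _] := subsetP sF A AF.
  by have := iA u v uA vA; rewrite euv.
have phi_inj : {in [set A in F | v \in A] &, injective phi}.
  move=> A B; rewrite !inE => /andP[AF vA] /andP[BF vB] eAB.
  rewrite -(setD1K vA) -(setD1K vB); congr (_ |: _).
  have uA : u \notin A :\ v by rewrite inE (negPf (uNA A AF vA)) andbF.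
  have uB : u \notin B :\ v by rewrite inE (negPf (uNA B BF vB)) andbF.
  by rewrite -(setU1K uA) -(setU1K uB) -/(phi A) -/(phi B) eAB.
have D1_inj : {in [set A : {set T} | v \in A] &, injective (fun A => A :\ v)}.
  by move=> A B; rewrite !inE => vA vB /(congr1 (setU [set v])); rewrite !setD1K.
have vF1 A : A \in F1 -> v \notin A.
  rewrite !inE => /orP[/andP[_ //]|/imsetP[B _ ->]].
  by rewrite !inE eqxx /= orbF eq_sym.
have cardF : #|F| <= #|F1| + #|F2|.
  have -> : #|F2| = #|Frest|.
    apply: card_in_imset => A B; rewrite !inE => /and3P[_ vA _] /and3P[_ vB _].
    by apply: D1_inj; rewrite inE.
  have -> : #|F1| = #|Fold| + #|Fnew|.
    rewrite cardsU; have -> : Fold :&: phi @: Fnew = set0.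
      apply/setP=> A; rewrite !inE; apply/negP => /andP[/andP[AF _] /imsetP[B]].
      by rewrite inE => /and4P[_ _ + _] eA; rewrite -eA AF.
    rewrite cards0 subn0 card_in_imset // => A B; rewrite !inE.
    move=> /and4P[AF vA _ _] /and4P[BF vB _ _].
    by apply: phi_inj; rewrite inE ?AF ?BF.
  have sub : F \subset Fold :|: Fnew :|: Frest.
    apply/subsetP=> A AF; rewrite !inE AF /=; case: (v \in A) => //=.
    by case: (_ && _).
  apply: leq_trans (subset_leq_card sub) _.
  by apply: leq_trans (leq_card_setU _ _) _; rewrite leq_add2r leq_card_setU.
have sF1 : F1 \subset indep_in (V :\ v) r.+1.
  apply/subsetP=> A AF1; have vA := vF1 A AF1; apply/indep_inP.
  case/setUP: AF1 => [|/imsetP[B]].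
    rewrite inE => /andP[AF _]; have /indep_inP[-> -> sA] := subsetP sF A AF.
    by split=> //; rewrite subsetD1 sA.
  rewrite inE => /and4P[BF vB _ ind] eA; rewrite eA; split=> //.
    rewrite cardsU1 inE (negPf (uNA B BF vB)) andbF /=.
    by have /indep_inP[_ <- _] := subsetP sF B BF; rewrite (cardsD1 v B) vB.
  rewrite subUset sub1set !inE uv uV; apply: setSD.
  by have /indep_inP[_ _] := subsetP sF B BF.
have iF1 : intersecting F1.
  (* A common element of [A] and [B] is not [v], since [A] avoids [v]; hence it survives the shift
     of [B]. *)
  have cross A B : A \in Fold -> B \in Fnew -> exists2 x, x \in A & x \in phi B.
    rewrite !inE => /andP[AF vA] /and4P[BF _ _ _].
    have [z zA zB] := iF A B AF BF; exists z => //; rewrite !inE zB andbT.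
    by apply/orP; right; apply: contraNneq vA => <-.
  apply/intersectingP=> A B /setUP[AF|/imsetP[A' AF ->]] /setUP[BF|/imsetP[B' BF ->]].
  - by move: AF BF; rewrite !inE => /andP[AF _] /andP[BF _]; exact: iF.
  - exact: cross.
  - by have [z] := cross B A' BF AF; exists z.
  - by exists u; rewrite !inE eqxx.
have sF2 : F2 \subset indep_in [set y in V :\ v | ~~ edge G v y] r.
  apply/subsetP=> ? /imsetP[A]; rewrite inE => /and3P[AF vA _ ->].
  have /indep_inP[indA cardA sA] := subsetP sF A AF; apply/indep_inP; split.
  - by apply: indepS indA; rewrite subD1set.
  - by apply: succn_inj; rewrite -cardA (cardsD1 v A) vA.
  - apply/subsetP=> y; rewrite !inE => /andP[-> yA]; rewrite (subsetP sA) //=.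
    by have /indepP[_ ->] := indA.
have iF2 : intersecting F2.
  (* The blocking neighbour of [u] lies in the independent set [A] together with [v], so it is not
     adjacent to [v] and must be [w]. *)
  have blocked A : A \in F -> v \in A -> ~~ independent G (phi A) -> w \in A :\ v.
    move=> AF vA; have /indep_inP[indA _ sA] := subsetP sF A AF.
    rewrite indepU1 //; last by apply: indepS indA; rewrite subD1set.
    rewrite negb_forall_in => /exists_inP[y yA /negPn euy].
    have [yv yA'] := setD1P yA.
    have [e|e|<- //] := nbu y (subsetP sA _ yA') euy.
      by rewrite e eqxx in yv.
    by have /indepP[_ /(_ v y vA yA')] := indA; rewrite e.
  (* Here the shifted set is itself in [F], so it meets [B]. The meeting point is not [u], because
     [B] contains the neighbour [v] of [u], and not [v], which the shift removed. *)
  have cross A B : phi A \in F -> B \in F -> v \in B ->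
      exists2 x, x \in A :\ v & x \in B :\ v.
    move=> AF BF vB; have [z] := iF _ _ AF BF.
    move=> /setU1P[->|zA] zB; first by rewrite (negPf (uNA B BF vB)) in zB.
    by exists z => //; rewrite inE zB andbT; case/setD1P: zA; rewrite !inE => ->.
  apply/intersectingP=> _ _ /imsetP[A AF ->] /imsetP[B BF ->]; move: AF BF.
  rewrite !inE !(negb_and (_ \notin _)) !negbK.
  move=> /and3P[AF vA /orP[A'|A']] /and3P[BF vB B'].
    exact: cross.
  case/orP: B' => B'; first by have [z] := cross B A B' AF vA; exists z.
  by exists w; exact: blocked.
apply: leq_trans cardF _.
apply: leq_trans (leq_add (bound1 F1 sF1 iF1) (bound2 F2 sF2 iF2)) _.
(* The star at [x] in [V] contains [S1], whose members avoid [v], and the members of [S2] enlarged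
   by [v]; these two parts are disjoint. *)
set S1 := star _ _; set S2 := star _ _; set S := star _ _.
have S2v A : A \in S2 -> v \notin A.
  rewrite inE => /andP[/indep_inP[_ _ /subsetP sA] _]; apply/negP => /sA.
  by rewrite !inE eqxx.
have <- : #|[set v |: A | A in S2]| = #|S2|.
  apply: card_in_imset => A B /S2v vA /S2v vB eAB.
  by rewrite -(setU1K vA) eAB setU1K.
rewrite -cardsUI [X in _ + #|pred_of_set X|](_ : _ = set0) ?cards0 ?addn0; last first.
  apply/setP=> A; rewrite [RHS]inE; apply/negbTE/negP => /setIP[+ /imsetP[B _ eA]].
  rewrite inE => /andP[/indep_inP[_ _ /subsetP/(_ v)]].
  by rewrite eA !inE eqxx => /(_ isT).
apply/subset_leq_card/subsetP => A /setUP[|/imsetP[B BS ->]].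
  rewrite !inE => /andP[/andP[-> sA] ->]; rewrite andbT /=.
  exact: subset_trans sA (subD1set _ _).
have vB := S2v B BS; move: BS; rewrite inE => /andP[/indep_inP[indB cardB sB] xB].
rewrite inE; apply/andP; split; last by rewrite inE xB orbT.
apply/indep_inP; split.
- rewrite indepU1 //; apply/forall_inP=> y /(subsetP sB).
  by rewrite inE => /andP[].
- by rewrite cardsU1 vB cardB.
- rewrite subUset sub1set vV; apply: subset_trans sB _.
  by apply/subsetP=> y; rewrite !inE => /andP[/andP[]].
Qed.

(** [W] stays fixed during the induction and will be the union of the cycles; only the path part is
    shortened. *)
Definition segment (p : nat -> T) W n : {set T} :=
  W :|: [set p i | i : 'I_n].

Lemma segmentP (p : nat -> T) W n y :
  reflect (y \in W \/ exists2 i, i < n & y = p i) (y \in segment p W n).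
Proof.
apply: (iffP setUP) => -[yW|]; try by left.
  by case/imsetP=> i _ ->; right; exists i.
by case=> i lt_in ->; right; apply/imsetP; exists (Ordinal lt_in).
Qed.

(** As [x] lies outside [W] and has no neighbour there, adding it is an injection into the star. *)
Lemma leq_card_star_link V W x r :
  W \subset V -> x \in V -> x \notin W -> V \subset vert G ->
  {in W, forall y, ~~ edge G x y} ->
  #|indep_in W r| <= #|star (indep_in V r.+1) x|.
Proof.
move=> sWV xV xW sV nxW.
have indW A : A \in indep_in W r -> x \notin A.
  by move=> /indep_inP[_ _ /subsetP sA]; apply: contraNN xW => /sA.
have <- : #|[set x |: A | A in indep_in W r]| = #|indep_in W r|.
  apply: card_in_imset => A B /indW xA /indW xB eAB.
  by rewrite -(setU1K xA) eAB setU1K.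
apply/subset_leq_card/subsetP => _ /imsetP[A AW ->].
have xA := indW A AW; have /indep_inP[indA cardA sA] := AW.
rewrite inE setU11 andbT; apply/indep_inP; split.
- rewrite indepU1 ?(subsetP sV) //; apply/forall_inP=> y /(subsetP sA).
  exact: nxW.
- by rewrite cardsU1 xA cardA.
- by rewrite subUset sub1set xV (subset_trans sA).
Qed.

(* [F0] collects the members avoiding the clique. Rotating the link at [p i] by
   [i + 1] steps makes all links pairwise disjoint, and disjoint from the
   shadow of [F0], because rotating an independent set by at most [n] steps
   gives a set disjoint from it. *)
Lemma star_bound_clique (p : nat -> T) W (rho : T -> T) n r :
  0 < n -> W \subset vert G ->
  (forall i, i < n -> p i \in vert G /\ p i \notin W) ->
  (forall i j, i < n -> j < n -> i != j -> edge G (p i) (p j)) ->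
  (forall i, i < n -> {in W, forall y, ~~ edge G (p i) y}) ->
  {in W, forall x, rho x \in W} -> {in W &, injective rho} ->
  {in W &, forall x y, edge G (rho x) (rho y) = edge G x y} ->
  {in W, forall x j, 0 < j <= n -> edge G x (iter j rho x)} ->
  star_bound (segment p W n) (p 0) r.
Proof.
move=> n_gt0 sW pV ppE pWE rhoW rho_inj rhoE rho_adj.
case: r => [|r]; first exact: star_bound0.
move=> F sF iF; have /intersectingP iFP := iF.
pose rot j A := iter j rho @: A.
have iterW j x : x \in W -> iter j rho x \in W.
  by elim: j x => // j IHj x xW; rewrite iterS rhoW ?IHj.
have iter_inj j : {in W &, injective (iter j rho)}.
  elim: j => [|j IHj] x y xW yW //; rewrite !iterS.
  by move/rho_inj => /(_ (iterW j x xW) (iterW j y yW)) /IHj; exact.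
have rot_inj j A B : A \subset W -> B \subset W -> rot j A = rot j B -> A = B.
  have half (C D : {set T}) :
      C \subset W -> D \subset W -> rot j C = rot j D -> C \subset D.
    move=> sC sD eCD; apply/subsetP=> x xC.
    have /imsetP[y yD /iter_inj->//] : iter j rho x \in rot j D.
      by rewrite -eCD imset_f.
      exact: (subsetP sC).
    exact: (subsetP sD).
  by move=> sA sB eAB; apply/eqP; rewrite eqEsubset (half A B) // (half B A).
have rotS j A : A \subset W -> rot j A \subset W.
  by move=> /subsetP sA; apply/subsetP=> _ /imsetP[x /sA xW ->]; exact: iterW.
have rot_indep j A : A \in indep_in W r -> rot j A \in indep_in W r.
  move=> /indep_inP[/indepP[_ iA] cardA sA]; apply/indep_inP; split.
  - apply/indepP; split; first exact: subset_trans (rotS j A sA) sW.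
    move=> _ _ /imsetP[x xA ->] /imsetP[y yA ->].
    elim: j => [|j IHj]; first exact: iA.
    by rewrite !iterS rhoE ?iterW ?(subsetP sA).
  - rewrite card_in_imset // => x y xA yA; apply: iter_inj; exact: (subsetP sA).
  - exact: rotS.
have rot_adj j A z : independent G A -> A \subset W -> 0 < j <= n ->
    z \in A -> iter j rho z \in A -> False.
  move=> /indepP[_ iA] sA jn zA zA'.
  by have := iA _ _ zA zA'; rewrite rho_adj ?(subsetP sA).
have memF A : A \in F -> [/\ independent G A, #|A| = r.+1 & A \subset segment p W n].
  by move=> AF; apply/indep_inP; exact: (subsetP sF).
pose F0 := [set A in F | A \subset W].
pose Q := [set q : 'I_n * {set T} | (q.2 \subset W) && (p q.1 |: q.2 \in F)].
(* The amount [q.1.+1] is never zero, since unrotated sets are reserved for the shadow of [F0], and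
   never exceeds [n]. *)
pose Psi (q : 'I_n * {set T}) := rot q.1.+1 q.2.
have memQ i A : (i, A) \in Q -> [/\ A \in indep_in W r, A \subset W & p i |: A \in F].
  rewrite inE /= => /andP[sA AF]; split=> //; apply/indep_inP; split=> //.
    by have [ind _ _] := memF _ AF; apply: indepS ind; rewrite subsetUr.
  have [_] := memF _ AF; rewrite cardsU1.
  have -> : p i \notin A by apply: contra (pV i (ltn_ord i)).2 => /(subsetP sA).
  by case.
(* A member of [F] outside [F0] contains exactly one clique vertex, and removing that vertex leaves
   a subset of [W]. *)
have cardF : #|F| <= #|F0| + #|Q|.
  have le_imQ := leq_imset_card (fun q : 'I_n * {set T} => p q.1 |: q.2) (mem Q).
  apply: leq_trans (leq_add (leqnn _) le_imQ).
  apply: leq_trans (leq_card_setU F0 _); apply/subset_leq_card/subsetP=> A AF.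
  rewrite inE inE AF /=; case: (boolP (A \subset W)) => //= /subsetPn[x xA xW].
  have [/indepP[_ iA] _ /subsetP sA] := memF A AF.
  have /segmentP[|[i lt_in xp]] := sA x xA; first by rewrite (negPf xW).
  apply/imsetP; exists (Ordinal lt_in, A :\ x); last by rewrite /= -xp setD1K.
  rewrite inE /= -xp setD1K // AF andbT; apply/subsetP=> y /setD1P[yx yA].
  have /segmentP[//|[j lt_jn yp]] := sA y yA.
  have ij : i != j by apply: contraNneq yx => eij; rewrite yp xp eij.
  by have := iA x y xA yA; rewrite xp yp ppE.
have shadowF0 : #|F0| <= #|shadow F0|.
  apply: (@leq_card_shadow _ _ r.+1) => [A|].
    by rewrite inE => /andP[/memF[]].
  by apply/intersectingP=> A B /setIdP[AF _] /setIdP[BF _]; exact: iFP.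
have sub_shadow : shadow F0 \subset indep_in W r.
  apply/subsetP=> _ /imset2P[A x /setIdP[AF sA] xA ->].
  have [ind cardA _] := memF A AF; apply/indep_inP; split.
  - by apply: indepS ind; rewrite subD1set.
  - by apply: succn_inj; rewrite -cardA (cardsD1 x A) xA.
  - exact: subset_trans (subD1set _ _) sA.
have sub_Psi : Psi @: Q \subset indep_in W r.
  apply/subsetP=> _ /imsetP[[i A] /memQ[AW _ _] ->]; exact: rot_indep.
(* Undoing the common [i.+1] steps gives [A = rot (j - i) B]. As [p i] and [p j] are distinct and
   outside [W], the two members meet in [A :&: B], so [B] contains some [y] and also its rotation by
   [j - i] steps, although these are adjacent. *)
have Psi_lt (i j : 'I_n) A B : i < j -> (i, A) \in Q -> (j, B) \in Q ->
    Psi (i, A) = Psi (j, B) -> False.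
  move=> lt_ij /memQ[AW sA AF] /memQ[BW sB BF].
  have -> : Psi (j, B) = rot i.+1 (rot (j - i) B).
    rewrite /rot -imset_comp; apply: eq_imset => x.
    by rewrite [RHS]/comp -iterD addSn subnKC // ltnW.
  move=> /rot_inj eA.
  have {}eA : A = rot (j - i) B by apply: eA => //; exact: rotS.
  have pij : p i != p j.
    apply/negP => /eqP e; have := ppE i j (ltn_ord i) (ltn_ord j).
    by rewrite e edge_irr neq_ltn lt_ij => /(_ isT).
  have pNW (l : 'I_n) (C : {set T}) : C \subset W -> p l \notin C.
    by move=> sC; apply: contra (pV l (ltn_ord l)).2 => /(subsetP sC).
  have [z /setU1P[->|zA] /setU1P[zpj|zB]] := iFP _ _ AF BF.
  - by rewrite zpj eqxx in pij.
  - by rewrite (negPf (pNW _ _ sB)) in zB.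
  - by rewrite zpj (negPf (pNW _ _ sA)) in zA.
  - move: zA; rewrite eA => /imsetP[y yB eyz].
    have /indep_inP[indB _ _] := BW.
    apply: (rot_adj (j - i) B y) => //; last by rewrite -eyz.
    by rewrite subn_gt0 lt_ij (leq_trans (leq_subr _ _)) // ltnW.
have Psi_inj : {in Q &, injective Psi}.
  move=> [i A] [j B] iA jB ePsi.
  case: (ltngtP i j) => [lt_ij|lt_ji|/val_inj eij].
  - by case: (Psi_lt _ _ _ _ lt_ij iA jB ePsi).
  - by case: (Psi_lt _ _ _ _ lt_ji jB iA (esym ePsi)).
  - subst j; have [_ sA _] := memQ _ _ iA; have [_ sB _] := memQ _ _ jB.
    by rewrite (rot_inj _ _ _ sA sB ePsi).
(* If [B :\ b] is the rotation of a link [A], then [B], lying in [W], meets [p i |: A] in some [z]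
   of [A]; the rotation of [z] is then in [B] too, yet adjacent to [z]. *)
have disj : shadow F0 :&: Psi @: Q = set0.
  apply/setP=> C; rewrite [RHS]inE; apply/negbTE/negP.
  case/setIP=> /imset2P[B b /setIdP[BF sB] bB eC] /imsetP[[i A] /memQ[AW sA AF] eC'].
  have [z /setU1P[->|zA] zB] := iFP _ _ AF BF.
    by have := subsetP sB _ zB; rewrite (negPf (pV i (ltn_ord i)).2).
  have [indB _ _] := memF B BF.
  apply: (rot_adj i.+1 B z) => //; first exact: ltn_ord.
  have : iter i.+1 rho z \in B :\ b by rewrite -eC eC'; exact: imset_f.
  by case/setD1P.
apply: leq_trans cardF _; apply: leq_trans (leq_add shadowF0 (leqnn _)) _.
rewrite -(card_in_imset Psi_inj) -cardsUI disj cards0 addn0.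
apply: leq_trans (_ : #|indep_in W r| <= _).
  by apply: subset_leq_card; rewrite subUset sub_shadow.
apply: leq_card_star_link.
- exact: subsetUl.
- by apply/segmentP; right; exists 0.
- exact: (pV 0 n_gt0).2.
- apply/subsetP=> y /segmentP[/(subsetP sW)//|[i lt_in ->]].
  exact: (pV i lt_in).1.
- exact: pWE.
Qed.

(** Strong induction on [n] with [r] varying. For [n <= k.+1] the path part is a clique. Otherwise
    [p n.-1] is shifted onto [p n.-2], whose only neighbour in the segment missed by [p n.-1] is
    [p (n.-2 - k)]; deleting [p n.-1], respectively it and its neighbours, leaves segments with
    [n.-1] and [n - k.+1] path vertices. *)
Lemma star_bound_segment (p : nat -> T) W (rho : T -> T) N k n r :
  0 < k -> 0 < n <= N -> W \subset vert G ->
  (forall i, i < N -> p i \in vert G /\ p i \notin W) ->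
  (forall i j, i < N -> j < N -> p i = p j -> i = j) ->
  (forall i j, i < N -> j < N ->
     edge G (p i) (p j) = (i != j) && (maxn i j - minn i j <= k)) ->
  (forall i, i < N -> {in W, forall y, ~~ edge G (p i) y}) ->
  {in W, forall x, rho x \in W} -> {in W &, injective rho} ->
  {in W &, forall x y, edge G (rho x) (rho y) = edge G x y} ->
  {in W, forall x j, 0 < j <= minn N k.+1 -> edge G x (iter j rho x)} ->
  star_bound (segment p W n) (p 0) r.
Proof.
move=> k_gt0 + sW pV p_inj pE pWE rhoW rho_inj rhoE rho_adj.
elim/ltn_ind: n r => n IHn r /andP[n_gt0 le_nN].
have [le_nk|lt_kn] := leqP n k.+1.
  apply: (@star_bound_clique _ _ rho) => //.
  - by move=> i lt_in; apply: pV; lia.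
  - move=> i j lt_in lt_jn ij; rewrite pE; lia.
  - by move=> i lt_in; apply: pWE; lia.
  - by move=> x xW j jn; apply: rho_adj => //; lia.
case: r => [|r]; first exact: star_bound0.
have segI i : i < n -> p i \in segment p W n.
  by move=> lt_in; apply/segmentP; right; exists i.
apply: (@star_bound_shift _ (p n.-1) (p n.-2) (p (n.-2 - k))).
- apply/subsetP=> y /segmentP[/(subsetP sW)//|[i lt_in ->]].
  by have [] := pV i; lia.
- by apply: segI; lia.
- by apply: segI; lia.
- by rewrite pE; lia.
- move=> y /segmentP[yW|[i lt_in ->]].
    by rewrite (negPf (pWE _ _ _ yW)) //; lia.
  rewrite pE; [|lia|lia] => /andP[i1 i2].
  have [->|i3] := eqVneq i n.-1; first by constructor 1.
  have [->|i4] := eqVneq i (n.-2 - k); first by constructor 3.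
  by constructor 2; rewrite pE; lia.
- by apply/eqP => /p_inj; lia.
- by rewrite pE; lia.
- rewrite (_ : _ :\ _ = segment p W n.-1); first by apply: IHn; lia.
  apply/setP=> y; rewrite in_setD1; apply/andP/segmentP.
    move=> [yp /segmentP[|[i lt_in e]]]; first by left.
    right; exists i => //; have : i != n.-1; last by lia.
    by apply: contraNneq yp => <-; rewrite e.
  case=> [yW|[i lt_in ->]].
    split; last by apply/segmentP; left.
    apply/negP => /eqP e; have [] := pV n.-1; first by lia.
    by rewrite -e yW.
  by split; [apply/eqP => /p_inj; lia|apply: segI; lia].
- rewrite (_ : [set y in _ | _] = segment p W (n - k.+1)); first by apply: IHn; lia.
  apply/setP=> y; rewrite inE in_setD1; apply/andP/segmentP.
    move=> [/andP[yp /segmentP[|[i lt_in e]]]]; first by left.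
    rewrite e pE; [|lia|lia] => Hi; right; exists i => //.
    have : i != n.-1; last by lia.
    by apply: contraNneq yp => <-; rewrite e.
  case=> [yW|[i lt_in ->]].
    split; last by apply: pWE => //; lia.
    apply/andP; split; last by apply/segmentP; left.
    apply/negP => /eqP e; have [] := pV n.-1; first by lia.
    by rewrite -e yW.
  split; last by rewrite pE; lia.
  by apply/andP; split; [apply/eqP => /p_inj; lia|apply: segI; lia].
Qed.

End Core.

(** * Powers of paths and cycles *)

Section Walks.
Variables (T : finType) (G : sgraph T).

Lemma has_walkP x y d :
  reflect (exists p, [/\ size p = d, path (edge G) x p & last x p = y])
    (has_walk G x y d).
Proof.
apply: (iffP existsP) => [[p /andP[pP /eqP e]]|[p [/eqP sz pP e]]].
  by exists p; rewrite size_tuple.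
by exists (Tuple sz); rewrite pP e eqxx.
Qed.

Lemma has_walk0 x y : has_walk G x y 0 = (x == y).
Proof.
apply/has_walkP/eqP => [[p [/size0nil-> _]] //|->].
by exists [::].
Qed.

Lemma has_walkS x y d :
  reflect (exists2 z, edge G x z & has_walk G z y d) (has_walk G x y d.+1).
Proof.
apply: (iffP (has_walkP _ _ _)) => [[[|z p] /=]|]; first by case.
  by case=> -[sz] /andP[xz pP] e; exists z => //; apply/has_walkP; exists p.
by case=> z xz /has_walkP[p [sz pP e]]; exists (z :: p); rewrite /= sz xz.
Qed.

Lemma has_walk_cat x y z c d :
  has_walk G x y c -> has_walk G y z d -> has_walk G x z (c + d).
Proof.
elim: c x => [|c IHc] x; first by rewrite has_walk0 => /eqP->.
case/has_walkS=> w xw wy yz; apply/has_walkS; exists w => //; exact: IHc.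
Qed.

(** Cutting out repetitions leaves a walk with fewer than [#|T|] edges, within the range searched by
    [dist]; the head of the filtered list is its minimum because [iota] is increasing. *)
Lemma dist_le x y d :
  has_walk G x y d -> exists2 d', dist G x y = Some d' & d' <= d.
Proof.
case/has_walkP=> p [sz pP e].
have [p' [p'P uniq_p' sub_p']] :
    exists p', [/\ path (edge G) x p' /\ last x p' = y,
                   uniq (x :: p') & size p' <= d].
  case/shortenP: pP e => p' p'P up' sub e; exists p'; split=> //.
  by rewrite -sz; apply: uniq_leq_size => //; case/andP: up'.
pose e' := size p'.
have we' : e' \in [seq d <- iota 0 #|T| | has_walk G x y d].
  rewrite mem_filter mem_iota /= add0n; apply/andP; split.
    by apply/has_walkP; exists p'; case: p'P.
  by rewrite -[e'.+1]/(size (x :: p')) -(card_uniqP uniq_p') max_card.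
have : sorted ltn [seq d <- iota 0 #|T| | has_walk G x y d].
  by apply: sorted_filter (iota_ltn_sorted _ _); exact: ltn_trans.
rewrite /dist; case: [seq _ <- _ | _] we' => [|a l] //= we' sl.
exists a => //; apply: leq_trans sub_p'; rewrite -/e'.
move: we'; rewrite inE => /predU1P[-> //|le].
by apply: ltnW; exact: (allP (order_path_min ltn_trans sl)).
Qed.

(** Any walk of length at most [k] is enough, so no distance has to be computed later. *)
Lemma power_edgeP k x y :
  reflect (x != y /\ exists2 d, d <= k & has_walk G x y d) (edge (power G k) x y).
Proof.
rewrite /= /power_edge /=.
apply: (iffP idP) => [|[xy [d le_dk /dist_le[d' ed le_d'd]]]].
  case ed: (dist G x y) => [d|] // /andP[d_gt0 le_dk]; split.
    apply: contraTneq d_gt0 => exy; move: ed; rewrite exy.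
    have /dist_le[d' -> + [<-]] : has_walk G y y 0 by rewrite has_walk0.
    by rewrite leqn0 => /eqP->.
  by exists d => //; exact: dist_walk.
rewrite ed (leq_trans le_d'd le_dk) andbT lt0n.
by apply: contra xy => /eqP d'0; move: (dist_walk ed); rewrite d'0 has_walk0.
Qed.

End Walks.

Lemma clique_omega (T : finType) (G : sgraph T) (A : {set T}) :
  clique G A -> #|A| <= omega G.
Proof. exact: (@leq_bigmax_cond _ _ (fun A : {set T} => #|A|)). Qed.

(** Labelling by [nat] reduces adjacency to arithmetic; values of [p] beyond [n] are artefacts of
    [inord], hence the bounds. *)
Lemma is_copy_ord (T : finType) n (H : sgraph 'I_n.+1) (G : sgraph T) :
  vert H = setT -> is_copy H G ->
  exists p : nat -> T,
    [/\ forall i j, i < n.+1 -> j < n.+1 -> p i = p j -> i = j,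
        vert G = [set p i | i : 'I_n.+1]
      & forall i j : 'I_n.+1, edge G (p i) (p j) = edge H i j].
Proof.
move=> eH [f]; rewrite eH => -[f_inj fG fE]; exists (f \o inord); split.
- move=> i j lt_in lt_jn /f_inj; rewrite !inE => /(_ isT isT) /(congr1 val).
  by rewrite /= !inordK.
- rewrite -fG; apply/setP=> y.
  by apply/imsetP/imsetP => -[i _ ->]; exists i; rewrite ?inE //= inord_val.
- by move=> i j; rewrite /= -fE ?inE // !inord_val.
Qed.

Section Line.
Variables (T : finType) (G : sgraph T) (p : nat -> T) (n : nat).
Hypothesis pE : forall i, i.+1 < n -> edge G (p i) (p i.+1).

Lemma has_walk_line i j : i <= j < n -> has_walk G (p i) (p j) (j - i).
Proof.
case/andP=> le_ij lt_jn; rewrite -{1}(subnKC le_ij).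
move: (j - i) (subnKC le_ij) => d; elim: d i le_ij => [|d IHd] i le_ij ed.
  by rewrite has_walk0 addn0.
apply/has_walkS; exists (p i.+1); first by apply: pE; lia.
by rewrite -addSnnS; apply: IHd; lia.
Qed.

Lemma has_walk_line_dist i j : i < n -> j < n ->
  has_walk G (p i) (p j) (maxn i j - minn i j).
Proof.
move=> lt_in lt_jn; have [le_ij|lt_ji] := leqP i j.
  by apply: has_walk_line; lia.
by rewrite has_walk_sym; apply: has_walk_line; lia.
Qed.

End Line.

Lemma path_powerP (T : finType) (P : sgraph T) : is_path P ->
  exists n p,
    [/\ 0 < n,
        forall i j, i < n -> j < n -> p i = p j -> i = j,
        forall x, x \in vert P <-> (exists2 i, i < n & x = p i)
      & (forall i j, i < n -> j < n -> edge P (p i) (p j) = (j == i.+1) || (i == j.+1))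
        /\ forall k i j, i < n -> j < n ->
          edge (power P k) (p i) (p j) = (i != j) && (maxn i j - minn i j <= k)].
Proof.
case=> -[//|n] _ /is_copy_ord[|p [p_inj pV pE']]; first by [].
have vertP x : x \in vert P <-> (exists2 i, i < n.+1 & x = p i).
  rewrite pV; split=> [/imsetP[i _ ->]|[i lt_in ->]]; first by exists i.
  by apply/imsetP; exists (Ordinal lt_in).
have pE i j : i < n.+1 -> j < n.+1 -> edge P (p i) (p j) = (j == i.+1) || (i == j.+1).
  move=> lt_in lt_jn; rewrite (pE' (Ordinal lt_in) (Ordinal lt_jn)) /= !inE -val_eqE /=.
  lia.
exists n.+1, p; split=> //; split=> // k i j lt_in lt_jn.
apply/power_edgeP/andP => -[ij].
  case=> d le_dk w; split; first by apply: contra ij => /eqP->.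
  (* Each edge changes the index by one, so [d] edges change it by at most [d]. *)
  suff : maxn i j - minn i j <= d by lia.
  elim: d i lt_in {le_dk ij} w => [|d IHd] i lt_in.
    rewrite has_walk0 => /eqP/p_inj; lia.
  case/has_walkS=> z iz; have /vertP[l lt_ln ez] : z \in vert P.
    by case/andP: (edge_vert iz).
  move: iz; rewrite ez pE // => il /(IHd l lt_ln); lia.
move=> le_ijk; split; first by apply/eqP => /p_inj; lia.
exists (maxn i j - minn i j) => //.
by apply: (@has_walk_line_dist _ _ _ n.+1) => // l lt_ln; rewrite pE; lia.
Qed.

(** The first [minn n k.+1] vertices of the path form a clique. *)
Lemma leq_omega_path (T : finType) (P : sgraph T) n (p : nat -> T) k :
  (forall i j, i < n -> j < n -> p i = p j -> i = j) ->
  (forall x, x \in vert P <-> (exists2 i, i < n & x = p i)) ->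
  (forall i j, i < n -> j < n ->
     edge (power P k) (p i) (p j) = (i != j) && (maxn i j - minn i j <= k)) ->
  minn n k.+1 <= omega (power P k).
Proof.
move=> p_inj vertP pE; set m := minn _ _.
have <- : #|[set p i | i : 'I_m]| = m.
  rewrite card_imset ?card_ord // => i j /p_inj eij; apply: val_inj.
  by apply: eij; have := ltn_ord i; have := ltn_ord j; lia.
apply: clique_omega; apply/andP; split.
  apply/subsetP=> _ /imsetP[i _ ->]; apply/vertP; exists i => //.
  by have := ltn_ord i; lia.
apply/forall_inP=> _ /imsetP[i _ ->]; apply/forall_inP=> _ /imsetP[j _ ->].
apply/implyP=> ij; have {}ij : i != j :> nat by apply: contraNneq ij => ->.
by have lt_im := ltn_ord i; have lt_jm := ltn_ord j; rewrite pE; lia.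
Qed.

Lemma cycle_powerP (T : finType) (C : sgraph T) : is_cycle C ->
  exists n p,
    [/\ 0 < n,
        forall i j, i < n -> j < n -> p i = p j -> i = j,
        forall x, x \in vert C <-> (exists2 i, i < n & x = p i)
      & forall k i j, i < n -> j < n ->
          edge (power C k) (p i) (p j) =
          (i != j) && ((maxn i j - minn i j <= k) || (n <= maxn i j - minn i j + k))].
Proof.
case=> -[//|n] n_ge3 /is_copy_ord[|p [p_inj pV pE']]; first by [].
have vertP x : x \in vert C <-> (exists2 i, i < n.+1 & x = p i).
  rewrite pV; split=> [/imsetP[i _ ->]|[i lt_in ->]]; first by exists i.
  by apply/imsetP; exists (Ordinal lt_in).
have pE i j : i < n.+1 -> j < n.+1 ->
    edge C (p i) (p j) =
    [|| j == i.+1, i == j.+1, (i == n) && (j == 0) | (j == n) && (i == 0)].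
  move=> lt_in lt_jn; rewrite (pE' (Ordinal lt_in) (Ordinal lt_jn)) /= !inE -val_eqE /=.
  lia.
exists n.+1, p; split=> // k i j lt_in lt_jn.
apply/power_edgeP/andP => -[ij].
  case=> d le_dk w; split; first by apply: contra ij => /eqP->.
  (* The second alternative accounts for walks through the closing edge; the cycle has [n.+1]
     vertices here, whence the strict inequality. *)
  suff : (maxn i j - minn i j <= d) || (n < maxn i j - minn i j + d) by lia.
  elim: d i lt_in {le_dk ij} w => [|d IHd] i lt_in.
    rewrite has_walk0 => /eqP/p_inj; lia.
  case/has_walkS=> z iz; have /vertP[l lt_ln ez] : z \in vert C.
    by case/andP: (edge_vert iz).
  move: iz; rewrite ez pE // => il /(IHd l lt_ln); lia.
have line a b : a < n.+1 -> b < n.+1 -> has_walk C (p a) (p b) (maxn a b - minn a b).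
  by apply: (@has_walk_line_dist _ _ _ n.+1) => // l lt_ln; rewrite pE; lia.
(* Descend from [p a] to [p 0], cross the closing edge to [p n], and descend to [p b]. *)
have around a b : a <= b < n.+1 -> has_walk C (p a) (p b) (a + (1 + (n - b))).
  move=> lt_abn; apply: (@has_walk_cat _ _ _ (p 0)).
    by have := line a 0; rewrite maxn0 minn0 subn0; apply; lia.
  apply: (@has_walk_cat _ _ _ (p n)).
    by apply/has_walkS; exists (p n); rewrite ?has_walk0 // pE; lia.
  have := line n b; have -> : maxn n b - minn n b = n - b by lia.
  by apply; lia.
move=> le_ijk; split; first by apply/eqP => /p_inj; lia.
case/orP: le_ijk => le_ijk.
  by exists (maxn i j - minn i j) => //; apply: line.
have [le_ij|lt_ji] := leqP i j.
  by exists (i + (1 + (n - j))); [lia|apply: around; lia].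
by exists (j + (1 + (n - i))); [lia|rewrite has_walk_sym; apply: around; lia].
Qed.

(** For residues below [n], this is cyclic distance at most [k]: equality or adjacency in the [k]-th
    power of the cycle. *)
Definition cyc_near n k i j :=
  [|| i == j, maxn i j - minn i j <= k | n <= maxn i j - minn i j + k].

(* Residues [a, ..., a + k] are sent to [0, ..., k] and residues
   [a - k, ..., a - 1] to [1, ..., k]. *)
Definition cyc_fold n k a i :=
  let d := if a <= i then i - a else i + n - a in
  if d <= k then d else d - (n - k.+1).

Lemma cyc_fold_lt n k a i : k.*2.+1 < n -> a < n -> i < n ->
  cyc_near n k a i -> cyc_fold n k a i < k.+1.
Proof.
rewrite /cyc_near /cyc_fold => ? ? ? ?.
by case: (leqP a i) => ?; case: ifP; lia.
Qed.

Lemma cyc_fold_inj n k a i j : k.*2.+1 < n -> a < n -> i < n -> j < n ->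
  cyc_near n k a i -> cyc_near n k a j -> cyc_near n k i j ->
  cyc_fold n k a i = cyc_fold n k a j -> i = j.
Proof.
rewrite /cyc_near /cyc_fold => ? ? ? ?.
by case: (leqP a i) => ?; case: (leqP a j) => ?; case: ifP => ?; case: ifP => ?; lia.
Qed.

(* For [2k + 2 <= n], a clique through [a] lies within distance [k] of [a], and
   [z] and [z + k + 1] are never both in it; this leaves at most [k + 1]
   residues. *)
Lemma omega_cycle_leq (T : finType) (C : sgraph T) n (p : nat -> T) k :
  (forall i j, i < n -> j < n -> p i = p j -> i = j) ->
  (forall x, x \in vert C <-> (exists2 i, i < n & x = p i)) ->
  (forall i j, i < n -> j < n ->
      edge (power C k) (p i) (p j) =
      (i != j) && ((maxn i j - minn i j <= k) || (n <= maxn i j - minn i j + k))) ->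
  omega (power C k) <= (if n <= k.*2.+1 then n else k.+1).
Proof.
move=> p_inj vertP pE; apply/bigmax_leqP => A /andP[sA /forall_inP clA].
pose S := [set i : 'I_n | p i \in A].
have cardA : #|A| <= #|S|.
  apply: leq_trans (leq_imset_card (fun i : 'I_n => p i) (mem S)).
  apply/subset_leq_card/subsetP => x xA; have /vertP[i lt_in ex] := subsetP sA x xA.
  by apply/imsetP; exists (Ordinal lt_in); rewrite ?inE -?ex.
apply: leq_trans cardA _; case: (leqP n) => [_|ltkn].
  by rewrite -[leqRHS]card_ord max_card.
have [->|/set0Pn[a aS]] := eqVneq S set0; first by rewrite cards0.
have adj (i j : 'I_n) : i \in S -> j \in S ->
    cyc_near n k i j.
  rewrite !inE => iA jA; have := implyP (forall_inP (clA _ iA) _ jA).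
  rewrite /cyc_near pE //; case: (eqVneq (i : nat) j) => //= ij; apply.
  by apply/eqP => /p_inj e; move: ij; rewrite e ?eqxx.
pose phi (i : 'I_n) : 'I_k.+1 := inord (cyc_fold n k a i).
rewrite -[leqRHS]card_ord -(card_in_imset (f := phi) (D := S)) ?max_card //.
move=> i j iS jS /(congr1 val) /=.
rewrite !inordK ?cyc_fold_lt ?adj // => /cyc_fold_inj e.
by apply: val_inj; apply: e; rewrite ?adj.
Qed.

(** Rotate by one step. If [n <= k.*2.+1], the power is complete and [j < n] steps move every vertex
    to another one; otherwise [omega_cycle_leq] gives [j <= k], so the image is within distance
    [k]. *)
Lemma cycle_rotation (T : finType) (C : sgraph T) k : is_cycle C ->
  exists rho : T -> T,
    [/\ {in vert C, forall x, rho x \in vert C},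
        {in vert C &, injective rho},
        {in vert C &, forall x y,
           edge (power C k) (rho x) (rho y) = edge (power C k) x y}
      & {in vert C, forall x j, 0 < j < omega (power C k) ->
           edge (power C k) x (iter j rho x)}].
Proof.
case/cycle_powerP=> n [p [n_gt0 p_inj vertP /(_ k) pE]].
have omega_le := omega_cycle_leq p_inj vertP pE.
pose next i := if i.+1 < n then i.+1 else 0.
(* [idx] inverts the labelling; the default label [0] is taken only off the cycle. *)
pose idx x := odflt (Ordinal n_gt0) [pick i : 'I_n | p i == x].
have idxK i : i < n -> idx (p i) = i :> nat.
  move=> lt_in; rewrite /idx; case: pickP => [j /eqP /p_inj -> //|].
  by move/(_ (Ordinal lt_in)); rewrite /= eqxx.
have next_lt i : next i < n by rewrite /next; case: ifP; lia.
exists (fun x => p (next (idx x))); split.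
- by move=> x _; apply/vertP; exists (next (idx x)).
- move=> _ _ /vertP[i lt_in ->] /vertP[j lt_jn ->]; rewrite !idxK // => /p_inj e.
  congr p; move: (e (next_lt _) (next_lt _)); rewrite /next.
  by case: ifP => ?; case: ifP; lia.
- move=> _ _ /vertP[i lt_in ->] /vertP[j lt_jn ->]; rewrite !idxK // !pE //.
  by rewrite /next; case: ifP => ?; case: ifP; lia.
- move=> _ /vertP[i lt_in ->] j jw.
  have lt_jn : j < n by move: omega_le jw; case: ifP; lia.
  have -> : iter j (fun x => p (next (idx x))) (p i) =
            p (if i + j < n then i + j else i + j - n).
    elim: j lt_jn {jw} => [|j IHj] lt_jn; first by rewrite addn0 lt_in.
    rewrite iterS IHj; last by lia.
    rewrite idxK; last by case: ifP; lia.
    congr p; rewrite /next.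
    by case: (ltnP (i + j) n) => ?; case: ifP => ?; case: ifP => ?; lia.
  move: omega_le jw; case: (leqP n k.*2.+1) => ? ? ?; case: ifP => ?; rewrite pE; lia.
Qed.

(** * Disjoint unions *)

(** The labelling [p] is a parameter, so that either end of the path can serve as [p 0]. *)
Lemma star_bound_union (T : finType) (s kstar : nat) (k : 'I_s -> nat)
    (P : sgraph T) (C : 'I_s -> sgraph T) (G : sgraph T) n (p : nat -> T) r :
  0 < kstar -> (forall i, is_cycle (C i)) ->
  disjoint_union
    (fun o => if o is Some i then power (C i) (k i) else power P kstar) G ->
  (forall i, omega (power P kstar) < omega (power (C i) (k i))) ->
  0 < n -> (forall i j, i < n -> j < n -> p i = p j -> i = j) ->
  (forall x, x \in vert P <-> exists2 i, i < n & x = p i) ->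
  (forall i j, i < n -> j < n ->
     edge (power P kstar) (p i) (p j) = (i != j) && (maxn i j - minn i j <= kstar)) ->
  star_bound G (vert G) (p 0) r.
Proof.
move=> kstar_gt0 cycleC [disjH vertG edgeG] omega_lt n_gt0 p_inj vertP pE.
have [rho_ /all_and4[rhoV rho_inj rhoE rho_adj]] :=
  fin_all_exists (fun i => cycle_rotation (k i) (cycleC i)).
pose H o := if o is Some i then power (C i) (k i) else power P kstar.
have edgeI o x y : x \in vert (H o) -> edge G x y = edge (H o) x y.
  move=> xo; rewrite edgeG; apply/existsP/idP => [[o' e]|e]; last by exists o.
  have [-> //|oo'] := eqVneq o o'; have /andP[xo' _] := edge_vert e.
  by have := disjointFr (disjH o o' oo') xo; rewrite xo'.
have C_uniq i j x : x \in vert (C i) -> x \in vert (C j) -> i = j.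
  move=> xi xj; apply/eqP; apply: contraT => ij.
  by have := disjointFr (disjH (Some i) (Some j) ij) xi; rewrite xj.
pose W := \bigcup_i vert (C i).
(* All cycles are rotated simultaneously; vertices outside them stay fixed. *)
pose rho x := if [pick i | x \in vert (C i)] is Some i then rho_ i x else x.
have rho_C i x : x \in vert (C i) -> rho x = rho_ i x.
  move=> xi; rewrite /rho; case: pickP => [j xj|/(_ i)]; last by rewrite xi.
  by rewrite (C_uniq _ _ _ xi xj).
have pH i : i < n -> p i \in vert (H None).
  by move=> lt_in; apply/vertP; exists i.
have iterC i x j : x \in vert (C i) ->
    iter j rho x = iter j (rho_ i) x /\ iter j rho x \in vert (C i).
  move=> xi; elim: j => [|j [IHe IHv]] //.
  by rewrite !iterS -IHe (rho_C i) ?rhoV.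
have pW i : i < n -> p i \notin W.
  move=> /pH pi; apply/negP => /bigcupP[j _ pj].
  by have := disjointFr (disjH None (Some j) isT) pi; rewrite pj.
have vertGE : vert G = segment p W n.
  apply/setP=> x; rewrite vertG; apply/bigcupP/segmentP.
    case=> -[i|] _ xo; [left|right]; last exact/vertP.
    by apply/bigcupP; exists i.
  case=> [/bigcupP[i _ xi]|[i lt_in ->]]; first by exists (Some i).
  by exists None => //; exact: pH.
have sWG : W \subset vert G by rewrite vertGE subsetUl.
rewrite vertGE; apply: (@star_bound_segment _ _ _ _ rho n kstar) => //.
- by rewrite n_gt0 leqnn.
- move=> i lt_in; split; last exact: pW.
  by rewrite vertGE; apply/segmentP; right; exists i.
- by move=> i j lt_in lt_jn; rewrite (edgeI None) ?pE //; exact: pH.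
- move=> i lt_in y yW; rewrite (edgeI None) ?pH //; apply/negP => /edge_vert/andP[_ yP].
  case/vertP: yP => j lt_jn ey; by have := pW j lt_jn; rewrite -ey yW.
- move=> x /bigcupP[i _ xi]; apply/bigcupP; exists i => //.
  by rewrite (rho_C i) ?rhoV.
- move=> x y /bigcupP[i _ xi] /bigcupP[j _ yj].
  rewrite (rho_C i) // (rho_C j) // => e; have eij : i = j.
    by apply: (C_uniq _ _ (rho_ i x)); [|rewrite e]; exact: rhoV.
  by subst j; apply: rho_inj e.
- move=> x y /bigcupP[i _ xi] /bigcupP[j _ yj].
  have rhox : rho x \in vert (C i) by rewrite (rho_C i) ?rhoV.
  have rhoy : rho y \in vert (C j) by rewrite (rho_C j) ?rhoV.
  rewrite (edgeI (Some i) (rho x)) // (edgeI (Some i) x) // /H.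
  have [eij|ij] := eqVneq i j.
    by subst j; rewrite !(rho_C i) // rhoE.
  have nC z t : t \in vert (C j) -> edge (power (C i) (k i)) z t = false.
    move=> tj; apply/negbTE/negP => /edge_vert/andP[_ ti].
    by move: ij; rewrite (C_uniq _ _ _ ti tj) eqxx.
  by rewrite !nC.
- move=> x /bigcupP[i _ xi] j /andP[j_gt0 le_j].
  rewrite (edgeI (Some i)) //= (iterC i x j xi).1; apply: rho_adj => //.
  (* The strict inequality of clique numbers enters here: [j] is at most [minn n kstar.+1], hence at
     most the clique number of the path power, hence below that of each cycle power. *)
  rewrite j_gt0 (leq_ltn_trans _ (omega_lt i)) // (leq_trans le_j) //.
  exact: leq_omega_path p_inj vertP pE.
Qed.

Lemma end_vertex_path (T : finType) (P : sgraph T) n (p : nat -> T) x :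
  (forall i j, i < n -> j < n -> p i = p j -> i = j) ->
  (forall x, x \in vert P <-> exists2 i, i < n & x = p i) ->
  (forall i j, i < n -> j < n -> edge P (p i) (p j) = (j == i.+1) || (i == j.+1)) ->
  end_vertex P x -> x = p 0 \/ x = p n.-1.
Proof.
move=> p_inj vertP pE /andP[/vertP[i lt_in ->] le1].
have [->|i0] := eqVneq i 0; first by left.
have [->|in1] := eqVneq i n.-1; first by right.
have : [set p i.-1; p i.+1] \subset [set y | edge P (p i) y].
  by apply/subsetP=> y; rewrite !inE => /orP[] /eqP->; rewrite pE; lia.
move/subset_leq_card; rewrite cards2.
have -> : p i.-1 != p i.+1 by apply/eqP => /p_inj; lia.
by move=> /leq_trans/(_ le1).
Qed.

Lemma star_largest (T : finType) (G : sgraph T) x r :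
  star_bound G (vert G) x r ->
  largest_intersecting (indep_family G r) (star (indep_family G r) x).
Proof.
have -> : star (indep_family G r) x = star (indep_in G (vert G) r) x.
  apply/setP=> A; rewrite !inE; case: (boolP (A \subset vert G)) => sA.
    by rewrite andbT.
  by rewrite /independent (negPf sA).
have indE : indep_family G r = indep_in G (vert G) r.
  apply/setP=> A; rewrite !inE /independent.
  by case: (A \subset _); rewrite ?andbF ?andbT.
move=> bound; rewrite indE; split.
- by apply/subsetP=> A /setIdP[].
- by apply/intersectingP=> A B /setIdP[_ xA] /setIdP[_ xB]; exists x.
- exact: bound.
Qed.

Theorem theorem4 (T : finType) (s kstar : nat) (k : 'I_s -> nat)
    (P : sgraph T) (C : 'I_s -> sgraph T) (G : sgraph T) (r : nat)
    (kstar_gt0 : 0 < kstar) (k_gt0 : forall i : 'I_s, 0 < k i)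
    (pathP : is_path P) (cycleC : forall i : 'I_s, is_cycle (C i))
    (unionG : disjoint_union
       (fun o : option 'I_s =>
          if o is Some i then power (C i) (k i) else power P kstar) G)
    (r_bounds : 1 <= r <= alpha G)
    (omega_lt : forall i : 'I_s,
       omega (power P kstar) < omega (power (C i) (k i))) :
  EKR G r /\
  (forall x : T, end_vertex P x ->
     largest_intersecting (indep_family G r) (star (indep_family G r) x)).
Proof.
have [n [p [n_gt0 p_inj vertP [pE /(_ kstar) powE]]]] := path_powerP pathP.
have bound q := @star_bound_union _ _ _ _ _ _ _ n q r
  kstar_gt0 cycleC unionG omega_lt n_gt0.
have bound0 : star_bound G (vert G) (p 0) r by exact: bound.
split.
  exists (p 0); last exact: star_largest.
  case: unionG => _ -> _; apply/bigcupP; exists None => //.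
  by apply/vertP; exists 0.
move=> x /(end_vertex_path p_inj vertP pE)[->|->]; apply: star_largest => //.
(* Reading the path backwards turns its last vertex into the first. *)
rewrite -[n.-1]subn0 -/((fun i => p (n.-1 - i)) 0).
apply: bound => [i j lt_in lt_jn|y|i j lt_in lt_jn].
- by move/p_inj; lia.
- rewrite vertP; split=> -[i lt_in ->]; exists (n.-1 - i); [lia|congr p; lia|lia|by []].
- by rewrite -[LHS]/(edge _ (p (n.-1 - i)) (p (n.-1 - j))) powE; lia.
Qed.
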